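(* Every $r$-convergent sequence in a cone metric space $(X,d)$ is bounded. (Here $r\in E$ with $0\ll r$ or $r=0$, and a sequence is called $r$-convergent if it is $r$-convergent to some $x\in X$.)
   Context: Let $E$ be a real Banach space. A subset $P\subset E$ is a cone if (i) $P$ is closed, nonempty and $P\neq\{0\}$; (ii) $a,b\in\mathbb{R}$, $a,b\ge 0$, $x,y\in P$ implies $ax+by\in P$; (iii) $x\in P$ and $-x\in P$ implies $x=0$. Write $x\le y$ if $y-x\in P$, $x<y$ if $x\le y$ and $x\ne y$, and $x\ll y$ if $y-x\in \mathrm{int}\,P$ (the interior of $P$). A cone metric space $(X,d)$ (associated with $E$ and $P$) is a nonempty set $X$ with a map $d:X\times X\to E$ such that for all $x,y,z\in X$: $0\le d(x,y)$, and $d(x,y)=0$ iff $x=y$; $d(x,y)=d(y,x)$; $d(x,y)\le d(x,z)+d(z,y)$. A sequence $\{x_n\}$ in $X$ is bounded if there exists $k\in E$ with $0\ll k$ such that $d(x_m,x_n)\ll k$ for all $m,n\in\mathbb{N}$. For $r\in E$ with $0\ll r$ or $r=0$, a sequence $\{x_n\}$ in $X$ is $r$-convergent to $x\in X$ if for every $\epsilon\in E$ with $0\ll\epsilon$ there is $k\in\mathbb{N}$ such that $d(x_n,x)\ll r+\epsilon$ for all $n\ge k$.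
   Formalization: The formal statement additionally assumes that the interior of P is nonempty; if int P is empty and r = 0, every sequence is vacuously 0-convergent while none is bounded, so the claim fails there. *)

(* Defs.v *)
From HB Require Import structures.
From mathcomp Require Import all_boot all_order all_algebra.
From mathcomp Require Import all_classical all_reals all_analysis.

Set Implicit Arguments.
Unset Strict Implicit.
Unset Printing Implicit Defensive.

Import Order.TTheory GRing.Theory Num.Theory.
Import numFieldNormedType.Exports.
Local Open Scope classical_set_scope.
Local Open Scope ring_scope.

Record is_cone (R : realType) (E : completeNormedModType R) (P : set E) : Prop :=
  IsCone {
    cone_closed : closed P;
    cone_nonempty : P !=set0;
    cone_neq0 : P <> [set 0];
    cone_comb : forall (a b : R) (x y : E),
      0 <= a -> 0 <= b -> P x -> P y -> P (a *: x + b *: y);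
    cone_pointed : forall x : E, P x -> P (- x) -> x = 0 }.

Definition cone_le (R : realType) (E : completeNormedModType R) (P : set E)
  (x y : E) : Prop := P (y - x).

Definition cone_ll (R : realType) (E : completeNormedModType R) (P : set E)
  (x y : E) : Prop := interior P (y - x).

Record is_cone_metric (R : realType) (E : completeNormedModType R) (P : set E)
    (X : Type) (d : X -> X -> E) : Prop :=
  IsConeMetric {
    cone_metric_inhabited : inhabited X;
    cone_metric_ge0 : forall x y, cone_le P 0 (d x y);
    cone_metric_eq0 : forall x y, d x y = 0 <-> x = y;
    cone_metric_sym : forall x y, d x y = d y x;
    cone_metric_triangle : forall x y z, cone_le P (d x y) (d x z + d z y) }.

Definition cone_bounded (R : realType) (E : completeNormedModType R) (P : set E)
    (X : Type) (d : X -> X -> E) (u : nat -> X) : Prop :=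
  exists k : E, cone_ll P 0 k /\ forall m n : nat, cone_ll P (d (u m) (u n)) k.

Definition r_convergent_to (R : realType) (E : completeNormedModType R)
    (P : set E) (X : Type) (d : X -> X -> E) (r : E) (u : nat -> X) (x : X) : Prop :=
  forall eps : E, cone_ll P 0 eps ->
    exists k : nat, forall n : nat, (k <= n)%N -> cone_ll P (d (u n) x) (r + eps).

Definition r_convergent (R : realType) (E : completeNormedModType R)
    (P : set E) (X : Type) (d : X -> X -> E) (r : E) (u : nat -> X) : Prop :=
  exists x : X, r_convergent_to P d r u x.

(* Main.v *)
(** Let [c n = d (u n) x]. Past some rank [K], [c n] is dominated by [r + e] for
    a fixed interior point [e]; adding the finitely many earlier distances gives
    one [b] with [c n << b] for every [n], and the triangle inequality through
    [x] then bounds all mutual distances by [b + b]. *)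
Require Import Defs.
From mathcomp Require Import all_boot all_order all_algebra.
From mathcomp Require Import all_classical all_reals all_analysis.
Import Order.TTheory GRing.Theory Num.Theory.
Import numFieldNormedType.Exports.
Local Open Scope classical_set_scope.
Local Open Scope ring_scope.

Section ConeInterior.
Context {R : realType} {E : completeNormedModType R} {P : set E}.
Hypothesis hP : is_cone P.

Lemma coneD (x y : E) : P x -> P y -> P (x + y).
Proof.
by move=> Px Py; rewrite -[x]scale1r -[y]scale1r; apply: (cone_comb hP).
Qed.

Lemma cone0 : P 0.
Proof.
have [x Px] := cone_nonempty hP.
by rewrite -[0]addr0 -(scale0r x); apply: (cone_comb hP).
Qed.

(** Translation by [- y] is continuous, so every [z] near [x + y] has [z - y] in [P]; adding [y]
    back stays in [P]. *)
Lemma interior_coneD (x y : E) : P° x -> P y -> P° (x + y).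
Proof.
move=> Px Py.
have cvg_shift : (z - y) @[z --> x + y] --> x.
  rewrite -[X in _ --> X](addrK y).
  by apply: cvgB; [exact: cvg_id|exact: cvg_cst].
have Pshift : \forall z \near x + y, P (z - y) by exact: cvg_shift Px.
by apply: filterS Pshift => z Pz; rewrite -(subrK y z); exact: coneD.
Qed.

(** The cone order need not be total, so the sum of the first [K] terms stands in for their maximum:
    removing one term leaves a sum of elements of [P]. *)
Lemma cone_initial_bound (c : nat -> E) (K : nat) :
  (forall n, P (c n)) ->
  exists2 s, P s & forall n, (n < K)%N -> P (s - c n).
Proof.
move=> Pc; elim: K => [|K [s Ps hs]]; first by exists 0 => //; exact: cone0.
exists (s + c K) => [|n]; first exact: coneD.
rewrite ltnS leq_eqVlt => /predU1P[->|/hs Psn]; first by rewrite addrK.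
by rewrite addrAC; exact: coneD.
Qed.

End ConeInterior.

Theorem theorem3p2 (R : realType) (E : completeNormedModType R) (P : set E)
  (hP : is_cone P) (hint : interior P !=set0)
  (X : Type) (d : X -> X -> E) (hd : is_cone_metric P d)
  (r : E) (hr : cone_ll P 0 r \/ r = 0) (u : nat -> X)
  (hu : r_convergent P d r u) :
  cone_bounded P d u.
Proof.
have [e Pe] := hint; have [x hx] := hu.
have [K hK] : exists k : nat, forall n : nat,
    (k <= n)%N -> cone_ll P (d (u n) x) (r + e).
  by apply: hx; rewrite /cone_ll subr0.
have Pd y z : P (d y z) by have := cone_metric_ge0 hd y z; rewrite /cone_le subr0.
have Pr : P r.
  case: hr => [|->]; last exact: cone0.
  by rewrite /cone_ll subr0 => /interior_subset.
have [s Ps hs] := cone_initial_bound hP (fun n => d (u n) x) K (fun n => Pd _ _).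
(* [e + r] dominates the tail and [s] the first [K] distances; [e] keeps the differences interior
   when [n < K]. *)
pose b := e + r + s.
have hb n : P° (b - d (u n) x).
  have [Kn|nK] := leqP K n.
    by rewrite /b addrAC (addrC e); apply: interior_coneD => //; exact: hK.
  rewrite /b -addrA; apply: interior_coneD => //; last exact: hs.
  exact: interior_coneD.
have hbb m n : P° (b + b - (d (u m) x + d (u n) x)).
  by rewrite opprD addrACA; apply: interior_coneD => //; exact: interior_subset.
exists (b + b); split=> [|m n].
  (* [b + b] is interior, being the case [m = n = 0] of [hbb] plus the cone element subtracted
     there. *)
  rewrite /cone_ll subr0 -(subrK (d (u 0%N) x + d (u 0%N) x) (b + b)).
  by apply: interior_coneD => //; exact: coneD.
have tri : P (d (u m) x + d (u n) x - d (u m) (u n)).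
  rewrite (cone_metric_sym hd (u n) x).
  exact: (cone_metric_triangle hd).
(* Adding the two differences cancels the distances to [x]. *)
have := interior_coneD hP _ _ (hbb m n) tri.
by rewrite addrA subrK.
Qed.
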